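(* If $f_1,f_2:\mathbb{R}^n\to\mathbb{R}$ are exact CN functions on $S$ (or weak uniform exact CN functions on $S$, or strong uniform exact CN functions on $S$), then the product $f_1f_2$ is a weak uniform exact CN function on $S$.
   Context: Let $S_1\subset\mathbb{R}^n$ be a convex set. A function $f:\mathbb{R}^n\to\mathbb{R}$ is a CN (convertible nonconvex) function on $S$ if there are $m$, a convex set $S=S_1\times S_2\subset\mathbb{R}^n\times\mathbb{R}^m$, and functions $g,g_1,\dots,g_r:\mathbb{R}^n\times\mathbb{R}^m\to\mathbb{R}$ ($r\ge1$), all convex on $S$, such that, with $X(\bm g)=\{(\bm x,\bm y)\in S: g_i(\bm x,\bm y)=0,\ i=1,\dots,r\}$, for each $\bm x\in S_1$ there is $\bm y\in\mathbb{R}^m$ with $(\bm x,\bm y)\in X(\bm g)$ and $f(\bm x)=g(\bm x,\bm y)=\min_{(\bm x,\bm y')\in X(\bm g)}g(\bm x,\bm y')$. It is an exact CN function on $S$ if such data exist for which, moreover, for each $\bm x\in S_1$ there is $\bm y$ with $(\bm x,\bm y)\in X(\bm g)$ and $f(\bm x)=g(\bm x,\bm y)=g(\bm x,\bm y')$ for all $\bm y'$ with $(\bm x,\bm y')\in X(\bm g)$. A CN (resp. exact CN) function is weak uniform (resp. strong uniform) if in such data $g$ can be chosen weak uniform convex (resp. strong uniform convex) on $S$: $g$ is differentiable and for every $\bm w\in S$ there is a positive semidefinite (resp. positive definite) symmetric matrix $B(\bm w)$ with $g(\bm w+\bm d)-g(\bm w)\ge\nabla g(\bm w)^\top\bm d+\frac12\bm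 d^\top B(\bm w)\bm d$ for all $\bm d$ with $\bm w+\bm d\in S$. When ''on $S$'' is asserted of several functions, $S_1$ is the same for all of them, while the number $m$ of auxiliary variables and the factor $S_2$ may differ from function to function. *)

(* Defs.v *)
From HB Require Import structures.
From mathcomp Require Import all_boot all_order all_algebra.
From mathcomp Require Import sesquilinear.
From mathcomp Require Import all_classical all_reals all_analysis.
Set Implicit Arguments.
Unset Strict Implicit.
Unset Printing Implicit Defensive.
Import Order.TTheory GRing.Theory Num.Theory.
Import numFieldNormedType.Exports.
Local Open Scope classical_set_scope.
Local Open Scope ring_scope.

(* Vectors are row vectors; a point                                            *)
(* (x, y) of R^n x R^m is row_mx x y : 'rV[R]_(n + m).                         *)

Definition prod_set (R : realType) (n m : nat) (S1 : set 'rV[R]_n)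
    (S2 : set 'rV[R]_m) : set 'rV[R]_(n + m) :=
  [set w | S1 (lsubmx w) /\ S2 (rsubmx w)].

Definition pos_semidefmx (R : realType) (k : nat) (B : 'M[R]_k) : Prop :=
  B \is symmetricmx /\ forall v : 'rV[R]_k, 0 <= (v *m B *m v^T) 0 0.

Definition pos_defmx (R : realType) (k : nat) (B : 'M[R]_k) : Prop :=
  B \is symmetricmx /\
  forall v : 'rV[R]_k, v != 0 -> 0 < (v *m B *m v^T) 0 0.

Definition gradient (R : realType) (k : nat) (g : 'rV[R]_k -> R)
    (w : 'rV[R]_k) : 'cV[R]_k :=
  \col_i 'D_(delta_mx 0 i) g w.

(* As d is a row vector, (grad g(w))^T d is d *m gradient g w, and d^T B d is  *)
(* d *m B *m d^T. Differentiability is required on the whole domain of g.      *)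
Definition uniform_convex_for (R : realType) (k : nat) (P : 'M[R]_k -> Prop)
    (S : set 'rV[R]_k) (g : 'rV[R]_k -> R) : Prop :=
  (forall w : 'rV[R]_k, differentiable g w) /\
  forall w, S w -> exists B : 'M[R]_k, P B /\
    forall d, S (w + d) ->
      (d *m gradient g w) 0 0 + 2^-1 * (d *m B *m d^T) 0 0 <= g (w + d) - g w.

Definition weak_uniform_convex (R : realType) (k : nat) (S : set 'rV[R]_k)
    (g : 'rV[R]_k -> R) : Prop :=
  uniform_convex_for (@pos_semidefmx R k) S g.

Definition strong_uniform_convex (R : realType) (k : nat) (S : set 'rV[R]_k)
    (g : 'rV[R]_k -> R) : Prop :=
  uniform_convex_for (@pos_defmx R k) S g.

Definition feasible (R : realType) (k r : nat) (S : set 'rV[R]_k)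
    (gs : 'I_r -> 'rV[R]_k -> R) : set 'rV[R]_k :=
  [set w | S w /\ forall i, gs i w = 0].

Definition cn_data (R : realType) (n m r : nat) (S1 : set 'rV[R]_n)
    (S2 : set 'rV[R]_m) (f : 'rV[R]_n -> R) (g : 'rV[R]_(n + m) -> R)
    (gs : 'I_r -> 'rV[R]_(n + m) -> R) : Prop :=
  let S := prod_set S1 S2 in
  let X := feasible S gs in
  [/\ (0 < r)%N,
      @convex_set R 'rV[R]_(n + m) S,
      @convex_function R 'rV[R]_(n + m) S g,
      forall i, @convex_function R 'rV[R]_(n + m) S (gs i) &
      forall x, S1 x -> exists y, [/\ X (row_mx x y), f x = g (row_mx x y) &
        forall y', X (row_mx x y') -> g (row_mx x y) <= g (row_mx x y')]].

Definition exact_cn_data (R : realType) (n m r : nat) (S1 : set 'rV[R]_n)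
    (S2 : set 'rV[R]_m) (f : 'rV[R]_n -> R) (g : 'rV[R]_(n + m) -> R)
    (gs : 'I_r -> 'rV[R]_(n + m) -> R) : Prop :=
  let X := feasible (prod_set S1 S2) gs in
  cn_data S1 S2 f g gs /\
  forall x, S1 x -> exists y, [/\ X (row_mx x y), f x = g (row_mx x y) &
    forall y', X (row_mx x y') -> g (row_mx x y) = g (row_mx x y')].

(* Only S1 is a parameter of the notions below: m and S2 depend on f.          *)
Definition exact_cn (R : realType) (n : nat) (S1 : set 'rV[R]_n)
    (f : 'rV[R]_n -> R) : Prop :=
  exists (m r : nat) (S2 : set 'rV[R]_m) (g : 'rV[R]_(n + m) -> R)
    (gs : 'I_r -> 'rV[R]_(n + m) -> R), exact_cn_data S1 S2 f g gs.

Definition weak_uniform_exact_cn (R : realType) (n : nat) (S1 : set 'rV[R]_n)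
    (f : 'rV[R]_n -> R) : Prop :=
  exists (m r : nat) (S2 : set 'rV[R]_m) (g : 'rV[R]_(n + m) -> R)
    (gs : 'I_r -> 'rV[R]_(n + m) -> R),
    exact_cn_data S1 S2 f g gs /\ weak_uniform_convex (prod_set S1 S2) g.

Definition strong_uniform_exact_cn (R : realType) (n : nat) (S1 : set 'rV[R]_n)
    (f : 'rV[R]_n -> R) : Prop :=
  exists (m r : nat) (S2 : set 'rV[R]_m) (g : 'rV[R]_(n + m) -> R)
    (gs : 'I_r -> 'rV[R]_(n + m) -> R),
    exact_cn_data S1 S2 f g gs /\ strong_uniform_convex (prod_set S1 S2) g.

(* Main.v *)
Require Import Defs.
From HB Require Import structures.
From mathcomp Require Import all_boot all_order all_algebra.
From mathcomp Require Import sesquilinear.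
From mathcomp Require Import all_classical all_reals all_analysis.
From mathcomp Require Import ring lra.
Set Implicit Arguments.
Unset Strict Implicit.
Unset Printing Implicit Defensive.
Import Order.TTheory GRing.Theory Num.Theory.
Import numFieldNormedType.Exports.
Local Open Scope classical_set_scope.
Local Open Scope ring_scope.

(** The product of two exact convertible nonconvex functions has a
    representation whose objective is linear, which is all that weak uniformity asks for.
    Represent f1 by (g1, gs1) with auxiliary variables y1 and f2 by (g2, gs2)
    with y2. Adjoin four real variables u1, u2, p, q and impose, besides the
    constraints gs1 on (x, y1) and gs2 on (x, y2),
      g1 (x, y1) - u1 = 0,  g2 (x, y2) - u2 = 0,
      u1^2 + u2^2 - p = 0,  (u1 + u2)^2 - q = 0.
    All left-hand sides are convex. Exactness of the two representations makes
    u1 = f1 x and u2 = f2 x at every feasible point over x, so there the linear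
    objective (q - p) / 2 equals u1 u2 = f1 x * f2 x. The nonconvexity of the
    product is thus moved entirely into the equality constraints.

    The general principle that a linear objective suffices is
    [weak_uniform_exact_cn_linear]; the construction is carried out in
    [product_weak_uniform_exact_cn]. *)

(** * Linear objectives *)

Lemma linear_row_differentiable (R : realType) (k : nat)
    (g : {linear 'rV[R]_k -> R}) (w : 'rV[R]_k) : differentiable g w.
Proof.
have -> : (g : 'rV[R]_k -> R) =
    \sum_(i < k) (fun v : 'rV[R]_k => v 0 i * g (delta_mx 0 i)).
  apply/funext => v; rewrite fct_sumE {1}[v]row_sum_delta linear_sum.
  by apply: eq_bigr => i _; rewrite linearZ.
apply: differentiable_sum => i.
by apply: differentiableM => //; exact: differentiable_coord.
Qed.

(** A linear function equals its own tangent, so the second-order lower bound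
    holds, with equality, for the zero matrix. *)
Lemma linear_weak_uniform_convex (R : realType) (k : nat) (S : set 'rV[R]_k)
    (g : {linear 'rV[R]_k -> R}) : weak_uniform_convex S g.
Proof.
have g_diff := linear_row_differentiable g; split=> // w _; exists 0; split.
  split; last by move=> v; rewrite mulmx0 mul0mx mxE.
  by rewrite is_hermitianmxE trmx0 map_mx0 scaler0 eqxx.
have g_cont : continuous g by move=> v; exact: differentiable_continuous.
move=> d _; rewrite mulmx0 mul0mx [X in _ + _ * X]mxE mulr0 addr0.
rewrite linearD addrAC subrr add0r.
rewrite {2}[d]row_sum_delta linear_sum mxE.
rewrite le_eqVlt; apply/orP; left; apply/eqP; apply: eq_bigr => i _.
by rewrite mxE deriveE // diff_lin // linearZ.
Qed.

(** * Convexity calculus *)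

Section Convexity.
Context (R : realType) (E : lmodType R).
Implicit Types (A B : set E) (f h : E -> R) (l : {linear E -> R^o}).

Let linear_formE l (t : {i01 R}) (x y : convex_lmodType E) :
  l (conv t x y) = t%:num * l x + (1 - t%:num) * l y.
Proof. by rewrite /conv /= linearD !linearZ. Qed.

Lemma convex_function_linear A l : @convex_function R E A l.
Proof. by move=> t x y _ _; rewrite convRE linear_formE. Qed.

Lemma convex_functionD A f h : @convex_function R E A f ->
  @convex_function R E A h -> @convex_function R E A (fun w => f w + h w).
Proof.
move=> fA hA t x y xA yA.
apply: (le_trans (lerD (fA t x y xA yA) (hA t x y xA yA))).
by rewrite !convRE !mulrDr addrACA.
Qed.

Lemma convex_functionB_linear A f l : @convex_function R E A f ->
  @convex_function R E A (fun w => f w - l w).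
Proof.
move=> fA; apply: convex_functionD => // t x y _ _.
by rewrite convRE linear_formE opprD !mulrN.
Qed.

Lemma convex_function_sqr_linear A l :
  @convex_function R E A (fun w => l w ^+ 2).
Proof.
move=> t x y _ _; rewrite convRE linear_formE.
have t0 : 0 <= t%:num by [].
have t1 : t%:num <= 1 by [].
rewrite -subr_ge0.
have -> : t%:num * l x ^+ 2 + (1 - t%:num) * l y ^+ 2
    - (t%:num * l x + (1 - t%:num) * l y) ^+ 2
    = t%:num * (1 - t%:num) * (l x - l y) ^+ 2 by ring.
by rewrite mulr_ge0 ?sqr_ge0 // mulr_ge0 // subr_ge0.
Qed.

Lemma convex_setI A B : @convex_set R E A -> @convex_set R E B ->
  @convex_set R E (A `&` B).
Proof.
move=> cA cB x y t /set_mem[xA xB] /set_mem[yA yB]; apply: mem_set.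
by split; apply: set_mem; [apply: cA | apply: cB]; exact: mem_set.
Qed.

Lemma convex_functionS A B f : B `<=` A -> @convex_function R E A f ->
  @convex_function R E B f.
Proof.
by move=> BA fA t x y xB yB; apply: fA; apply/mem_set/BA/set_mem.
Qed.

End Convexity.

Section LinearPreimage.
Context (R : realType) (E F : lmodType R) (p : {linear E -> F}).

Lemma linear_conv (t : {i01 R}) (x y : convex_lmodType E) :
  p (conv t x y) = conv t (p x : convex_lmodType F) (p y).
Proof. by rewrite /conv /= linearD !linearZ. Qed.

Lemma convex_set_preimage (A : set F) :
  @convex_set R F A -> @convex_set R E (p @^-1` A).
Proof.
move=> cA x y t; rewrite !inE /= linear_conv => xA yA.
by apply/set_mem/cA; exact/mem_set.
Qed.

Lemma convex_function_preimage (A : set F) (f : F -> R) :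
  @convex_function R F A f -> @convex_function R E (p @^-1` A) (f \o p).
Proof.
move=> fA t x y; rewrite !inE /= linear_conv => xA yA.
by apply: fA; exact/mem_set.
Qed.

End LinearPreimage.

(** * Representations with a linear objective *)

(** With a linear objective that is constantly f x on each fibre of the
    feasible set, minimality, exactness and weak uniformity are automatic; what
    is left is nonemptiness of the fibres and convexity of the domain and of
    the constraints. The
    constraints range over an arbitrary finite type, so that families can be
    joined by sums of index types. *)
Lemma weak_uniform_exact_cn_linear (R : realType) (n m : nat) (I : finType)
    (S1 : set 'rV[R]_n) (S2 : set 'rV[R]_m) (f : 'rV[R]_n -> R)
    (g : {linear 'rV[R]_(n + m) -> R^o}) (gs : I -> 'rV[R]_(n + m) -> R) :
  (0 < #|I|)%N ->
  @convex_set R 'rV[R]_(n + m) (prod_set S1 S2) ->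
  (forall i, @convex_function R 'rV[R]_(n + m) (prod_set S1 S2) (gs i)) ->
  (forall x, S1 x -> exists y,
     prod_set S1 S2 (row_mx x y) /\ forall i, gs i (row_mx x y) = 0) ->
  (forall x y, prod_set S1 S2 (row_mx x y) ->
     (forall i, gs i (row_mx x y) = 0) -> g (row_mx x y) = f x) ->
  weak_uniform_exact_cn S1 f.
Proof.
move=> I0 cS cgs ex gE.
pose es (j : 'I_#|I|) := gs (enum_val j).
have gX x y : feasible (prod_set S1 S2) es (row_mx x y) -> g (row_mx x y) = f x.
  case=> Sxy g0; apply: gE Sxy _ => i.
  by have := g0 (enum_rank i); rewrite /es enum_rankK.
have exX x : S1 x -> exists y, [/\ feasible (prod_set S1 S2) es (row_mx x y),
    f x = g (row_mx x y) & forall y', feasible (prod_set S1 S2) es (row_mx x y') ->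
    g (row_mx x y) = g (row_mx x y')].
  move=> /ex[y [Sxy g0]]; exists y.
  have gxy : g (row_mx x y) = f x by exact: gE.
  split=> // [|y' /gX -> //]; split=> // i; exact: g0.
exists m, #|I|, S2, g, es; split; last exact: linear_weak_uniform_convex.
split=> //; split=> //.
- exact: convex_function_linear.
- by move=> j; exact: cgs.
by move=> x /exX[y [Xy fE gy]]; exists y; split=> // y' /gy ->.
Qed.

(** * The product construction *)

Section Product.
Context (R : realType) (n m1 m2 r1 r2 : nat) (S1 : set 'rV[R]_n).
Context (T1 : set 'rV[R]_m1) (T2 : set 'rV[R]_m2).
Context (f1 f2 : 'rV[R]_n -> R).
Context (g1 : 'rV[R]_(n + m1) -> R) (gs1 : 'I_r1 -> 'rV[R]_(n + m1) -> R).
Context (g2 : 'rV[R]_(n + m2) -> R) (gs2 : 'I_r2 -> 'rV[R]_(n + m2) -> R).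
Hypothesis fg1 : exact_cn_data S1 T1 f1 g1 gs1.
Hypothesis fg2 : exact_cn_data S1 T2 f2 g2 gs2.

Local Notation V := 'rV[R]_(n + (m1 + m2 + 4)).

Let p1 (w : V) := row_mx (lsubmx w) (lsubmx (lsubmx (rsubmx w))).
Let p2 (w : V) := row_mx (lsubmx w) (rsubmx (lsubmx (rsubmx w))).

Let p1_linear : linear p1.
Proof. by move=> a u v; rewrite /p1 !linearP /= scale_row_mx add_row_mx. Qed.

Let p2_linear : linear p2.
Proof. by move=> a u v; rewrite /p2 !linearP /= scale_row_mx add_row_mx. Qed.

HB.instance Definition _ := GRing.isLinear.Build _ _ _ _ p1 p1_linear.
HB.instance Definition _ := GRing.isLinear.Build _ _ _ _ p2 p2_linear.

(** The last four auxiliary variables are u1, u2, p, q; their linear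
    forms provide both the objective and the linear terms of the adjoined
    constraints. *)
Let combination (c : 'cV[R]_4) (w : V) : R^o := (rsubmx (rsubmx w) *m c) 0 0.

Let combination_linear c : linear (combination c).
Proof.
by move=> a u v; rewrite /combination !linearP /= mulmxDl -scalemxAl !mxE.
Qed.
HB.instance Definition _ c :=
  GRing.isLinear.Build _ _ _ _ (combination c) (combination_linear c).

Let coef (a b c d : R) : 'cV[R]_4 := \col_i nth 0 [:: a; b; c; d] i.

Let combinationE x y a b c d a' b' c' d' :
  combination (coef a' b' c' d') (row_mx x (row_mx y (coef a b c d)^T)) =
  a * a' + b * b' + c * c' + d * d'.
Proof.
rewrite /combination !row_mxKr mxE !big_ord_recr big_ord0 /= !mxE /=.
by rewrite add0r.
Qed.

Let T : set 'rV[R]_(m1 + m2 + 4) :=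
  [set y | T1 (lsubmx (lsubmx y)) /\ T2 (rsubmx (lsubmx y))].

(** Convexity of the new domain is obtained from this description rather than
    from convexity of T1 and T2, which need not hold when S1 is empty. *)
Let prod_setE : prod_set S1 T =
  p1 @^-1` prod_set S1 T1 `&` p2 @^-1` prod_set S1 T2.
Proof.
apply/seteqP; split=> w; rewrite /prod_set /p1 /p2 /= !row_mxKl !row_mxKr.
  by case=> Sx [T1y T2y].
by case=> -[Sx T1y] [_ T2y].
Qed.

Let constraint (i : 'I_r1 + 'I_r2 + 'I_4) (w : V) : R :=
  match i with
  | inl (inl j) => gs1 j (p1 w)
  | inl (inr j) => gs2 j (p2 w)
  | inr k => nth 0
     [:: g1 (p1 w) - combination (coef 1 0 0 0) w;
         g2 (p2 w) - combination (coef 0 1 0 0) w;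
         combination (coef 1 0 0 0) w ^+ 2 + combination (coef 0 1 0 0) w ^+ 2
           - combination (coef 0 0 1 0) w;
         combination (coef 1 1 0 0) w ^+ 2 - combination (coef 0 0 0 1) w] k
  end.

Let constraint_convex i : @convex_function R V (prod_set S1 T) (constraint i).
Proof.
have [[_ _ cg1 cgs1 _] _] := fg1; have [[_ _ cg2 cgs2 _] _] := fg2.
have pull1 (h : 'rV[R]_(n + m1) -> R) :
    @convex_function R 'rV[R]_(n + m1) (prod_set S1 T1) h ->
    @convex_function R V (prod_set S1 T) (fun w => h (p1 w)).
  move=> /(@convex_function_preimage _ _ _ p1); apply: convex_functionS.
  by rewrite prod_setE; exact: subIsetl.
have pull2 (h : 'rV[R]_(n + m2) -> R) :
    @convex_function R 'rV[R]_(n + m2) (prod_set S1 T2) h ->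
    @convex_function R V (prod_set S1 T) (fun w => h (p2 w)).
  move=> /(@convex_function_preimage _ _ _ p2); apply: convex_functionS.
  by rewrite prod_setE; exact: subIsetr.
case: i => [[j|j]|[[|[|[|[|//]]]] k4]] /=.
- exact: pull1.
- exact: pull2.
- by apply: convex_functionB_linear; exact: pull1.
- by apply: convex_functionB_linear; exact: pull2.
- apply: convex_functionB_linear.
  by apply: convex_functionD; exact: convex_function_sqr_linear.
- by apply: convex_functionB_linear; exact: convex_function_sqr_linear.
Qed.

Let aux (y1 : 'rV[R]_m1) (y2 : 'rV[R]_m2) (a b c d : R) :
  'rV[R]_(m1 + m2 + 4) := row_mx (row_mx y1 y2) (coef a b c d)^T.

Let auxP y : exists y1 y2 a b c d, y = aux y1 y2 a b c d.
Proof.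
exists (lsubmx (lsubmx y)), (rsubmx (lsubmx y)).
pose z k : R := rsubmx y 0 k.
exists (z 0), (z 1), (z 2), (z 3).
rewrite /aux hsubmxK -[LHS]hsubmxK; congr row_mx; apply/rowP => -[k k4].
rewrite !mxE /=; case: k k4 => [|[|[|[|//]]]] k4 /=;
  by rewrite /z mxE; congr (y 0 _); exact: val_inj.
Qed.

Let p1E x y1 y2 a b c d : p1 (row_mx x (aux y1 y2 a b c d)) = row_mx x y1.
Proof. by rewrite /p1 !(row_mxKl, row_mxKr). Qed.

Let p2E x y1 y2 a b c d : p2 (row_mx x (aux y1 y2 a b c d)) = row_mx x y2.
Proof. by rewrite /p2 !(row_mxKl, row_mxKr). Qed.

Lemma product_weak_uniform_exact_cn :
  weak_uniform_exact_cn S1 (fun x => f1 x * f2 x).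
Proof.
have [[_ cS1 _ _ _] ex1] := fg1; have [[_ cS2 _ _ _] ex2] := fg2.
apply: (@weak_uniform_exact_cn_linear _ _ _ _ _ T _
  (combination (coef 0 0 (- 2^-1) 2^-1)) constraint).
- by rewrite !card_sum !card_ord addnC.
- rewrite prod_setE; apply: convex_setI.
    exact: (@convex_set_preimage _ _ _ p1).
  exact: (@convex_set_preimage _ _ _ p2).
- exact: constraint_convex.
- move=> x S1x.
  have [y1 [[Sy1 gy1] fE1 _]] := ex1 _ S1x.
  have [y2 [[Sy2 gy2] fE2 _]] := ex2 _ S1x.
  exists (aux y1 y2 (f1 x) (f2 x) (f1 x ^+ 2 + f2 x ^+ 2) ((f1 x + f2 x) ^+ 2)).
  rewrite prod_setE /=; split; first by rewrite p1E p2E.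
  case=> [[j|j]|[[|[|[|[|//]]]] k4]] /=.
  + by rewrite p1E gy1.
  + by rewrite p2E gy2.
  + by rewrite p1E -fE1 combinationE; ring.
  + by rewrite p2E -fE2 combinationE; ring.
  + by rewrite !combinationE; ring.
  + by rewrite !combinationE; ring.
move=> x y; have [y1 [y2 [a [b [c [d ->]]]]]] := auxP y.
rewrite prod_setE /= p1E p2E => -[Sy1 Sy2] g0.
have S1x : S1 x by case: Sy1; rewrite row_mxKl.
have [z1 [_ fE1 gE1]] := ex1 _ S1x; have [z2 [_ fE2 gE2]] := ex2 _ S1x.
(* Exactness is used here: g1 and g2 take the values f1 x and f2 x at an
   arbitrary feasible point, not only at a minimizer. *)
have g1E : g1 (row_mx x y1) = f1 x.
  rewrite fE1 -gE1 //; split=> // j.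
  by have := g0 (inl (inl j)); rewrite /= p1E.
have g2E : g2 (row_mx x y2) = f2 x.
  rewrite fE2 -gE2 //; split=> // j.
  by have := g0 (inl (inr j)); rewrite /= p2E.
have := g0 (inr 0); have := g0 (inr 1); have := g0 (inr 2); have := g0 (inr 3).
rewrite /= p1E p2E g1E g2E !combinationE.
rewrite !(mulr0, mulr1, addr0, add0r) => dE cE.
move=> /subr0_eq u2E /subr0_eq u1E; subst.
by lra.
Qed.

End Product.

Theorem proposition2p5 (R : realType) (n : nat) (S1 : set 'rV[R]_n)
    (f1 f2 : 'rV[R]_n -> R) (S1_convex : @convex_set R 'rV[R]_n S1)
    (f12 : [\/ exact_cn S1 f1 /\ exact_cn S1 f2,
               weak_uniform_exact_cn S1 f1 /\ weak_uniform_exact_cn S1 f2 |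
               strong_uniform_exact_cn S1 f1 /\ strong_uniform_exact_cn S1 f2]) :
  weak_uniform_exact_cn S1 (fun x => f1 x * f2 x).
Proof.
have [h1 h2] : exact_cn S1 f1 /\ exact_cn S1 f2.
  case: f12 => [//|[u1 u2]|[u1 u2]];
    have [m1 [r1 [T1 [g1 [gs1 [e1 _]]]]]] := u1;
    have [m2 [r2 [T2 [g2 [gs2 [e2 _]]]]]] := u2;
    by split; [exists m1, r1, T1, g1, gs1 | exists m2, r2, T2, g2, gs2].
have [m1 [r1 [T1 [g1 [gs1 e1]]]]] := h1.
have [m2 [r2 [T2 [g2 [gs2 e2]]]]] := h2.
exact: product_weak_uniform_exact_cn e1 e2.
Qed.
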